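(* Let $F_7^{-4}$ be the rank-$3$ matroid on $\{0,1,2,3,0',1',2'\}$ whose bases are all $3$-element subsets except $\{3,0,0'\},\{3,1,1'\},\{3,2,2'\}$, and let $F_7^{-5}$ be the rank-$3$ matroid on $\{0,1,2,4,0',1',2'\}$ whose bases are all $3$-element subsets except $\{4,0,0'\},\{4,2,2'\}$. Let $P_1\in\mathbb{R}[x_0,x_1,x_2,x_3]$ and $P_2\in\mathbb{R}[x_0,x_1,x_2,x_4]$ be obtained from the bases generating polynomials $h_{F_7^{-4}}=\sum_B\prod_{i\in B}x_i$ and $h_{F_7^{-5}}=\sum_B\prod_{i\in B}x_i$ respectively by substituting $x_{0'}=x_0$, $x_{1'}=x_1$, $x_{2'}=x_2$. Let $J_1=\operatorname{supp}(P_1)\subseteq\mathbb{N}_0^{\{0,1,2,3\}}$, $J_2=\operatorname{supp}(P_2)\subseteq\mathbb{N}_0^{\{0,1,2,4\}}$ and $r_k=r_{J_k}$ for $k=1,2$. Then for every $m\in\mathbb{N}$, the polymatroids $m\cdot r_1$ on $\{0,1,2,3\}$ and $m\cdot r_2$ on $\{0,1,2,4\}$ do not have an amalgam.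
   Context: The support $\operatorname{supp}(P)$ of a polynomial is the set of exponent vectors of its monomials with nonzero coefficient. For $J\subseteq\mathbb{N}_0^E$ finite and nonempty, $r_J\colon 2^E\to\mathbb{N}_0$ is $r_J(S)=\max\{\sum_{i\in S}\alpha_i\mid\alpha\in J\}$. A polymatroid on a finite set $E$ is a function $r\colon2^E\to\mathbb{N}_0$ with $r(\emptyset)=0$, $r(S)\le r(T)$ for $S\subseteq T$, and $r(S\cup T)+r(S\cap T)\le r(S)+r(T)$. $m\cdot r$ denotes the function $S\mapsto m\,r(S)$. For polymatroids $r_1$ on $E_1$ and $r_2$ on $E_2$, an amalgam is a polymatroid $r$ on $E_1\cup E_2$ with $r(S)=r_1(S)$ for all $S\subseteq E_1$ and $r(S)=r_2(S)$ for all $S\subseteq E_2$. *)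

(* Defs.v *)
From mathcomp Require Import all_boot all_order all_algebra.
From mathcomp Require Import reals.
From mathcomp Require Import mpoly.

Set Implicit Arguments.
Unset Strict Implicit.
Unset Printing Implicit Defensive.

Import Order.TTheory GRing.Theory Num.Theory.

Local Open Scope nat_scope.

Record matroid (T : finType) := Matroid {
  ground : {set T};
  bases : {set {set T}};
  _ : bases != set0;
  _ : forall B, B \in bases -> B \subset ground;
  _ : forall A B, A \in bases -> B \in bases -> forall x, x \in A :\: B ->
        exists2 y, y \in B :\: A & y |: (A :\ x) \in bases }.

(* The ground set E is a subset of an ambient type T, so that polymatroids on
   overlapping ground sets can be compared. Only the values on subsets of E are
   meaningful. *)
Definition is_polymatroid (T : finType) (E : {set T}) (r : {set T} -> nat) :=
  [/\ r set0 = 0,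
      forall S U : {set T}, S \subset U -> U \subset E -> r S <= r U
    & forall S U : {set T}, S \subset E -> U \subset E ->
        r (S :|: U) + r (S :&: U) <= r S + r U].

Record polymatroid (T : finType) (E : {set T}) := Polymatroid {
  polymatroid_fun :> {set T} -> nat;
  polymatroidP : is_polymatroid E polymatroid_fun }.

Lemma scale_subproof (T : finType) (E : {set T}) (m : nat)
  (r : polymatroid E) : is_polymatroid E (fun S => m * r S).
Proof.
case: r => r [r0 rM rS] /=; split=> [|S U sSU sUE|S U sSE sUE].
- by rewrite r0 muln0.
- by rewrite leq_mul2l rM ?orbT.
- by rewrite -!mulnDr leq_mul2l rS ?orbT.
Qed.

Definition scale (T : finType) (E : {set T}) (m : nat) (r : polymatroid E) :
  polymatroid E := Polymatroid (scale_subproof m r).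

Definition is_amalgam (T : finType) (E1 E2 : {set T})
    (r1 : polymatroid E1) (r2 : polymatroid E2)
    (r : polymatroid (E1 :|: E2)) :=
  (forall S : {set T}, S \subset E1 -> r S = r1 S) /\
  (forall S : {set T}, S \subset E2 -> r S = r2 S).

Definition rank_of (n : nat) (J : seq 'X_{1..n}) (S : {set 'I_n}) : nat :=
  \max_(a <- J) \sum_(i in S) a i.

Definition bases_poly (R : comNzRingType) (n : nat) (M : matroid 'I_n) :
  {mpoly R[n]} := (\sum_(B in bases M) \prod_(i in B) 'X_i)%R.

(* Substitution of x_(f i) for x_i. *)
Definition subst_vars (R : comNzRingType) (n k : nat) (f : 'I_n -> 'I_k)
  (p : {mpoly R[n]}) : {mpoly R[k]} := p \mPo [tuple 'X_(f i) | i < n].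

Section TriplesAvoiding.

Variables (T : finType) (E : {set T}) (L : {set {set T}}).

Definition triples_avoiding : {set {set T}} :=
  [set B : {set T} | [&& B \subset E, #|B| == 3 & B \notin L]].

Lemma triples_avoiding_sub B : B \in triples_avoiding -> B \subset E.
Proof. by rewrite inE => /and3P[]. Qed.

Lemma triples_avoiding_exchange :
  (forall A B, A \in L -> B \in L -> A != B -> #|A :&: B| <= 1) ->
  forall A B, A \in triples_avoiding -> B \in triples_avoiding ->
  forall x, x \in A :\: B ->
  exists2 y, y \in B :\: A & y |: (A :\ x) \in triples_avoiding.
Proof.
move=> L1 A B; rewrite !inE => /and3P[sAE /eqP cA nA] /and3P[sBE /eqP cB nB] x.
rewrite inE => /andP[xB xA].
have cAx : #|A :\ x| = 2 by move: cA; rewrite (cardsD1 x) xA => -[].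
have ground_ok y : y \in B :\: A ->
    (y |: (A :\ x) \subset E) && (#|y |: (A :\ x)| == 3).
  rewrite inE => /andP[yA yB]; rewrite cardsU1 cAx !inE (negbTE yA) andbF /=.
  rewrite subUset sub1set (subsetP sBE) //= (subset_trans _ sAE) //.
  exact: subD1set.
have cBA : #|B :\: A| = #|A :\: B|.
  have := cardsID A B; have := cardsID B A; rewrite (setIC B A) cA cB => <-.
  by move/addnI.
have /card_gt0P[y yBA] : 0 < #|B :\: A|.
  by rewrite cBA; apply/card_gt0P; exists x; rewrite inE xB.
have [yL|yL] := boolP (y |: (A :\ x) \in L); last first.
  by exists y => //; rewrite inE yL andbT ground_ok.
have [/existsP[z /andP[zBA zL]]|] :=
    boolP [exists z, (z \in B :\: A) && (z |: (A :\ x) \notin L)].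
  by exists z => //; rewrite inE zL andbT ground_ok.
rewrite negb_exists => /forallP noz.
have eqy z : z \in B :\: A -> z = y.
  move=> zBA; apply/eqP/negPn/negP => zy.
  have zL : z |: (A :\ x) \in L by have := noz z; rewrite zBA negbK.
  have ne : z |: (A :\ x) != y |: (A :\ x).
    apply/eqP => /setP/(_ z); rewrite !inE eqxx /= (negbTE zy) /=.
    by move: zBA; rewrite inE => /andP[/negbTE-> _]; rewrite andbF.
  have := L1 _ _ zL yL ne; apply/negP; rewrite -ltnNge -cAx subset_leq_card //.
  by rewrite subsetI !subsetUr.
case/negP: nB; suff -> : B = y |: (A :\ x) by [].
apply/eqP; rewrite eqEcard cB; apply/andP; split; last first.
  by have /andP[_ /eqP->] := ground_ok y yBA.
apply/subsetP => z zB; rewrite !inE; have [zA|zA] := boolP (z \in A).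
  by rewrite andbT orbC; apply/orP; left; apply: contraNneq xB => <-.
by rewrite (eqy z) ?eqxx // inE zA.
Qed.

End TriplesAvoiding.

(* Labels of the matroid elements 0, 1, 2, 3, 4, 0', 1', 2'. *)
Definition e0 : 'I_8 := @Ordinal 8 0 isT.
Definition e1 : 'I_8 := @Ordinal 8 1 isT.
Definition e2 : 'I_8 := @Ordinal 8 2 isT.
Definition e3 : 'I_8 := @Ordinal 8 3 isT.
Definition e4 : 'I_8 := @Ordinal 8 4 isT.
Definition e0' : 'I_8 := @Ordinal 8 5 isT.
Definition e1' : 'I_8 := @Ordinal 8 6 isT.
Definition e2' : 'I_8 := @Ordinal 8 7 isT.

(* Labels of the variables x_0, ..., x_4. *)
Definition v0 : 'I_5 := @Ordinal 5 0 isT.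
Definition v1 : 'I_5 := @Ordinal 5 1 isT.
Definition v2 : 'I_5 := @Ordinal 5 2 isT.
Definition v3 : 'I_5 := @Ordinal 5 3 isT.
Definition v4 : 'I_5 := @Ordinal 5 4 isT.

Definition unprime : 'I_8 -> 'I_5 :=
  tnth [tuple v0; v1; v2; v3; v4; v0; v1; v2].

Definition groundF74 : {set 'I_8} := [set e0; e1; e2; e3; e0'; e1'; e2'].
Definition nonbasesF74 : {set {set 'I_8}} :=
  [set [set e3; e0; e0']; [set e3; e1; e1']; [set e3; e2; e2']].

Definition groundF75 : {set 'I_8} := [set e0; e1; e2; e4; e0'; e1'; e2'].
Definition nonbasesF75 : {set {set 'I_8}} :=
  [set [set e4; e0; e0']; [set e4; e2; e2']].

Lemma e012_basis (E : {set 'I_8}) (L : {set {set 'I_8}}) :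
  [set e0; e1; e2] \subset E ->
  (forall A, A \in L -> (e3 \in A) || (e4 \in A)) ->
  triples_avoiding E L != set0.
Proof.
move=> sE LP; apply/set0Pn; exists [set e0; e1; e2]; rewrite inE sE /=.
apply/andP; split; last by apply/negP => /LP; rewrite !inE.
by rewrite -sum1_card big_mkcond /= !big_ord_recl big_ord0 !inE.
Qed.

Lemma basesF74_neq0 : triples_avoiding groundF74 nonbasesF74 != set0.
Proof.
apply: e012_basis; first by rewrite !subUset !sub1set !inE.
by move=> A; rewrite !inE => /orP[/orP[]|] /eqP->; rewrite !inE.
Qed.

Lemma basesF75_neq0 : triples_avoiding groundF75 nonbasesF75 != set0.
Proof.
apply: e012_basis; first by rewrite !subUset !sub1set !inE.
by move=> A; rewrite !inE => /orP[] /eqP->; rewrite !inE.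
Qed.

Lemma nonbasesF74_meet (A B : {set 'I_8}) :
  A \in nonbasesF74 -> B \in nonbasesF74 -> A != B -> #|A :&: B| <= 1.
Proof.
rewrite !inE => /orP[/orP[]|] /eqP-> /orP[/orP[]|] /eqP->;
  rewrite ?eqxx //= => _;
  by rewrite -sum1_card big_mkcond /= !big_ord_recl big_ord0 !inE.
Qed.

Lemma nonbasesF75_meet (A B : {set 'I_8}) :
  A \in nonbasesF75 -> B \in nonbasesF75 -> A != B -> #|A :&: B| <= 1.
Proof.
rewrite !inE => /orP[] /eqP-> /orP[] /eqP->; rewrite ?eqxx //= => _;
  by rewrite -sum1_card big_mkcond /= !big_ord_recl big_ord0 !inE.
Qed.

Definition F74 : matroid 'I_8 :=
  Matroid basesF74_neq0 (@triples_avoiding_sub _ groundF74 nonbasesF74)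
    (triples_avoiding_exchange nonbasesF74_meet).

Definition F75 : matroid 'I_8 :=
  Matroid basesF75_neq0 (@triples_avoiding_sub _ groundF75 nonbasesF75)
    (triples_avoiding_exchange nonbasesF75_meet).

Section RankIsPolymatroid.

Variables (R : numDomainType) (n k : nat) (M : matroid 'I_n).
Variable f : 'I_n -> 'I_k.
Hypothesis bases_card3 : forall B, B \in bases M -> #|B| = 3.

Let mon (B : {set 'I_n}) : 'X_{1..k} := (\sum_(i in B) U_(f i))%MM.

Lemma mpolyX_sum_mon (B : {set 'I_n}) :
  'X_[mon B] = (\prod_(i in B) 'X_(f i))%R :> {mpoly R[k]}.
Proof. by rewrite /mon (big_morph _ (@mpolyXD k R) (@mpolyX0 k R)). Qed.

Lemma subst_bases_polyE :
  subst_vars f (bases_poly R M) = (\sum_(B in bases M) 'X_[mon B])%R.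
Proof.
rewrite /subst_vars /bases_poly raddf_sum /=; apply: eq_bigr => B _.
rewrite rmorph_prod /= mpolyX_sum_mon; apply: eq_bigr => i _.
by rewrite comp_mpolyXU -tnth_nth tnth_mktuple.
Qed.

Lemma mem_msupp_subst a :
  a \in msupp (subst_vars f (bases_poly R M)) ->
  exists2 B, B \in bases M & a = mon B.
Proof.
rewrite subst_bases_polyE mcoeff_msupp raddf_sum /= => nz.
have [/existsP[B /andP[BM /eqP aE]]|] :=
  boolP [exists B, (B \in bases M) && (a == mon B)]; first by exists B.
rewrite negb_exists => /forallP no; case/eqP: nz; apply: big1 => B BM.
by rewrite mcoeffX; have := no B; rewrite BM /= eq_sym => /negbTE->.
Qed.

Lemma mon_msupp B :
  B \in bases M -> mon B \in msupp (subst_vars f (bases_poly R M)).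
Proof.
move=> BM; rewrite subst_bases_polyE mcoeff_msupp raddf_sum /= (bigD1 B) //=.
rewrite mcoeffX eqxx gt_eqF // ltr_wpDr ?ltr01 ?sumr_ge0 // => A _.
by rewrite mcoeffX ler0n.
Qed.

Let r := rank_of (msupp (subst_vars f (bases_poly R M))).

Lemma sum_mon B (S : {set 'I_k}) : \sum_(i in S) mon B i = #|B :&: f @^-1: S|.
Proof.
under eq_bigr => i _ do rewrite mnm_sumE.
rewrite exchange_big /= -sum1_card.
rewrite (eq_bigl (fun j => (j \in B) && (f j \in S))); last first.
  by move=> j; rewrite !inE.
rewrite big_mkcondr /=; apply: eq_bigr => j _.
under eq_bigr => i _ do rewrite mnm1E.
have [fS|fS] := boolP (f j \in S).
  rewrite (bigD1 (f j)) //= eqxx big1 ?addn0 // => i /andP[_].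
  by rewrite eq_sym => /negbTE->.
rewrite big1 // => i iS; case: eqP => // fE.
by rewrite fE iS in fS.
Qed.

Lemma msupp_subst_vanish (a : 'X_{1..k}) i :
  a \in msupp (subst_vars f (bases_poly R M)) ->
  i \notin f @: ground M -> a i = 0.
Proof.
case/mem_msupp_subst => B BM -> iE; rewrite /mon mnm_sumE big1 // => j jB.
rewrite mnm1E; case: eqP => // fj; case/negP: iE; rewrite -fj imset_f //.
by apply: subsetP jB; case: (M) BM => G BB ? sub ? /= /sub.
Qed.

Lemma rank_ge B (S : {set 'I_k}) : B \in bases M -> #|B :&: f @^-1: S| <= r S.
Proof.
move=> BM; rewrite -sum_mon /r /rank_of.
by rewrite (leq_bigmax_seq (F := fun a : 'X_{1..k} => \sum_(i in S) a i) (mon B)) ?mon_msupp.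
Qed.

Lemma rank_max (S : {set 'I_k}) : exists2 B, B \in bases M & r S = #|B :&: f @^-1: S|.
Proof.
have [B0 B0M] : exists B, B \in bases M.
  by apply/set0Pn; case: (M).
have: r S <= r S by []; rewrite {2}/r /rank_of.
have [B BM Bmax] := @arg_maxnP _ B0 (mem (bases M))
  (fun B => #|B :&: f @^-1: S|) B0M.
move=> _; exists B => //; apply/eqP; rewrite eqn_leq rank_ge // andbT.
apply/bigmax_leqP_seq => a /mem_msupp_subst[A AM ->] _.
by rewrite sum_mon; apply: Bmax.
Qed.

Lemma rank_max2 (S U : {set 'I_k}) : S \subset U ->
  exists B, [/\ B \in bases M, r S = #|B :&: f @^-1: S|
                             & r U = #|B :&: f @^-1: U|].
Proof.
move=> sSU; have [C CM rC] := rank_max U; have [A AM rA] := rank_max S.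
have [d] := ubnP #|A :\: C|; elim: d => // d IHd in A AM rA *.
rewrite ltnS => leAd.
have [?|neU] := eqVneq (r U) #|A :&: f @^-1: U|; first by exists A.
have ltU : #|A :&: f @^-1: U| < #|C :&: f @^-1: U|.
  by rewrite -rC ltn_neqAle eq_sym neU rank_ge.
have ltD : #|C :\: f @^-1: U| < #|A :\: f @^-1: U|.
  rewrite -(ltn_add2l #|C :&: f @^-1: U|) cardsID (bases_card3 CM).
  by rewrite -(bases_card3 AM) -(cardsID (f @^-1: U) A) ltn_add2r.
have [x xA] : exists x, x \in (A :\: f @^-1: U) :\: C.
  apply/set0Pn; rewrite setD_eq0; apply: contraL ltD => sAC; rewrite -leqNgt.
  apply/subset_leq_card/subsetP => z zAU; have zC := subsetP sAC z zAU.
  by move: zAU; rewrite !inE zC => /andP[->].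
move: xA; rewrite !inE => /and3P[xC xU xA].
have [y] : exists2 y, y \in C :\: A & y |: (A :\ x) \in bases M.
  by case: (M) AM CM => G BB ? ? /= exch AM CM; apply: exch; rewrite ?inE ?xC.
rewrite inE => /andP[yA yC] A'M.
apply: (IHd _ A'M); last first.
  apply: leq_trans leAd; apply: proper_card; apply/properP; split.
    apply/subsetP => z; rewrite !inE => /andP[zC /orP[/eqP zy|/andP[_ ->]]].
      by rewrite zy yC in zC.
    by rewrite zC.
  exists x; rewrite !inE ?xC ?xA // eqxx /= orbF.
  by apply: contraNneq xC => ->.
apply/eqP; rewrite eqn_leq rank_ge // andbT rA subset_leq_card //.
apply/subsetP => z; rewrite !inE => /andP[zA zS]; rewrite zS zA !andbT.
apply/orP; right; apply: contraNneq xU => <-; exact: (subsetP sSU).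
Qed.

Lemma rank_of_polymatroid (E : {set 'I_k}) : is_polymatroid E r.
Proof.
split=> [|S U sSU _|S U _ _].
- by have [B _ ->] := rank_max set0; rewrite preimset0 setI0 cards0.
- have [B BM ->] := rank_max S; apply: leq_trans (rank_ge U BM).
  by rewrite subset_leq_card // setIS // preimsetS.
have [B [BM -> ->]] := rank_max2 (subset_trans (subsetIl S U) (subsetUl S U)).
rewrite preimsetU preimsetI setIUr setIIr cardsUI.
by rewrite leq_add ?rank_ge.
Qed.

End RankIsPolymatroid.

Lemma F74_card3 B : B \in bases F74 -> #|B| = 3.
Proof. by rewrite inE => /and3P[_ /eqP]. Qed.

Lemma F75_card3 B : B \in bases F75 -> #|B| = 3.
Proof. by rewrite inE => /and3P[_ /eqP]. Qed.

Definition E1 : {set 'I_5} := [set v0; v1; v2; v3].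
Definition E2 : {set 'I_5} := [set v0; v1; v2; v4].

(* P1 and P2 live in R[x_0, ..., x_4]; x_4 does not occur in P1, nor x_3 in P2,
   so their supports J1 and J2 consist of exponent vectors vanishing outside E1
   and E2 respectively. *)
Definition P1 (R : realType) : {mpoly R[5]} :=
  subst_vars unprime (bases_poly R F74).
Definition P2 (R : realType) : {mpoly R[5]} :=
  subst_vars unprime (bases_poly R F75).

Definition J1 (R : realType) : seq 'X_{1..5} := msupp (P1 R).
Definition J2 (R : realType) : seq 'X_{1..5} := msupp (P2 R).

Lemma J1_E1 (R : realType) a i : a \in J1 R -> i \notin E1 -> a i = 0.
Proof.
move=> aJ iE; apply: (msupp_subst_vanish aJ); apply: contra iE.
case/imsetP => j; rewrite !inE -!orbA.
by do ![case/orP => [/eqP->->|]]; move=> // /eqP->->.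
Qed.

Lemma J2_E2 (R : realType) a i : a \in J2 R -> i \notin E2 -> a i = 0.
Proof.
move=> aJ iE; apply: (msupp_subst_vanish aJ); apply: contra iE.
case/imsetP => j; rewrite !inE -!orbA.
by do ![case/orP => [/eqP->->|]]; move=> // /eqP->->.
Qed.

Definition r1 (R : realType) : polymatroid E1 :=
  Polymatroid (rank_of_polymatroid R unprime F74_card3 E1).
Definition r2 (R : realType) : polymatroid E2 :=
  Polymatroid (rank_of_polymatroid R unprime F75_card3 E2).

Lemma r1E (R : realType) S : r1 R S = rank_of (J1 R) S.
Proof. by []. Qed.

Lemma r2E (R : realType) S : r2 R S = rank_of (J2 R) S.
Proof. by []. Qed.

(* Main.v *)
(** In [r1] and [r2] the variables 0, 1, 2 are lines of a plane and 3, 4 are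
    points: 3 lies on the lines 0, 1, 2, while 4 lies on 0 and 2 but not on 1.
    In an amalgam, both points lie on the two distinct lines 0 and 2, so
    submodularity makes 3 and 4 parallel; then 4 lies on line 1 together with 3,
    a contradiction. All inequalities used are homogeneous, so scaling by [m]
    changes nothing. *)
Require Import Defs.
From mathcomp Require Import all_boot all_order all_algebra.
From mathcomp Require Import reals.
From mathcomp Require Import mpoly.
From mathcomp Require Import zify.

(** A basis with three elements over [S] would lie inside [l], hence equal the nonbasis [l]. *)
Lemma rank_le2 (R : realType) (n k : nat) (M : matroid 'I_n) (f : 'I_n -> 'I_k)
    (E : {set 'I_n}) (L : {set {set 'I_n}}) (l : {set 'I_n}) (S : {set 'I_k}) :
  bases M = triples_avoiding E L -> l \in L -> #|l| <= 3 ->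
  E :&: f @^-1: S \subset l ->
  rank_of (msupp (subst_vars f (bases_poly R M))) S <= 2.
Proof.
move=> basesE lL l3 sl; have [B + ->] := rank_max R M f S.
rewrite basesE inE => /and3P[sBE /eqP cB nB]; rewrite leqNgt -cB.
apply: contra nB => le_cB.
have sBS : B \subset f @^-1: S by apply/setIidPl/eqP; rewrite eqEcard subsetIl.
suff -> : B = l by [].
apply/eqP; rewrite eqEcard cB l3 andbT; apply: subset_trans sl.
by rewrite subsetI sBE.
Qed.

(** Makes cardinalities of explicit sets computable by expanding eight membership tests. *)
Lemma card_set_ord8 (A : {set 'I_8}) : #|A| = \sum_(i < 8) (i \in A).
Proof. by rewrite -sum1_card big_mkcond; apply: eq_bigr => i _; case: ifP. Qed.

Ltac decide_ord8 :=
  by rewrite ?inE ?card_set_ord8 ?big_ord_recl ?big_ord0 ?eqEsubset ?subUset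
             ?sub1set ?inE.

Ltac decide_subset :=
  by apply/subsetP => -[[|[|[|[|[|[|[|[|?]]]]]]]] ?] //; rewrite !inE.

Lemma r1_values (R : realType) :
  [/\ 2 <= r1 R [set v0], 2 <= r1 R [set v2], 1 <= r1 R [set v3],
      3 <= r1 R [set v0; v2] &
      [/\ r1 R [set v0; v3] <= 2, r1 R [set v1; v3] <= 2
        & r1 R [set v2; v3] <= 2]].
Proof.
have ge (B : {set 'I_8}) (S : {set 'I_5}) :
  B \in bases F74 -> #|B :&: unprime @^-1: S| <= r1 R S by exact: rank_ge.
have le (l : {set 'I_8}) (S : {set 'I_5}) : l \in nonbasesF74 -> #|l| <= 3 ->
    groundF74 :&: unprime @^-1: S \subset l -> r1 R S <= 2.
  exact: (@rank_le2 R _ _ F74).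
split; last split.
(* Each witness is a basis with as many elements over [S] as the bound requires. *)
- apply: leq_trans (ge [set e0; e0'; e1] _ _); decide_ord8.
- apply: leq_trans (ge [set e2; e2'; e1] _ _); decide_ord8.
- apply: leq_trans (ge [set e3; e0; e1] _ _); decide_ord8.
- apply: leq_trans (ge [set e0; e0'; e2] _ _); decide_ord8.
(* The ground elements over [S] form exactly one nonbasis. *)
- apply: (le [set e3; e0; e0']); [decide_ord8.. | decide_subset].
- apply: (le [set e3; e1; e1']); [decide_ord8.. | decide_subset].
- apply: (le [set e3; e2; e2']); [decide_ord8.. | decide_subset].
Qed.

Lemma r2_values (R : realType) :
  [/\ 3 <= r2 R [set v1; v4], r2 R [set v0; v4] <= 2
    & r2 R [set v2; v4] <= 2].
Proof.
have ge (B : {set 'I_8}) (S : {set 'I_5}) :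
  B \in bases F75 -> #|B :&: unprime @^-1: S| <= r2 R S by exact: rank_ge.
have le (l : {set 'I_8}) (S : {set 'I_5}) : l \in nonbasesF75 -> #|l| <= 3 ->
    groundF75 :&: unprime @^-1: S \subset l -> r2 R S <= 2.
  exact: (@rank_le2 R _ _ F75).
split.
(* Here the two matroids differ: 4, 1, 1' form a basis, whereas 3, 1, 1' do not. *)
- apply: leq_trans (ge [set e1; e1'; e4] _ _); decide_ord8.
- apply: (le [set e4; e0; e0']); [decide_ord8.. | decide_subset].
- apply: (le [set e4; e2; e2']); [decide_ord8.. | decide_subset].
Qed.

Theorem theorem3p5 (R : realType) (m : nat) (hm : (0 < m)%N) :
  ~ exists r : polymatroid (E1 :|: E2),
      is_amalgam (scale m (r1 R)) (scale m (r2 R)) r.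
Proof.
case=> r [H1 H2].
have [_ rM rS] := polymatroidP r.
have E12 (A : {set 'I_5}) : A \subset E1 :|: E2.
  by apply/subsetP => -[[|[|[|[|[|?]]]]] ?] // _; rewrite !inE.
(* Submodularity with union and intersection given pointwise, so that each instance is checked on
   five elements. *)
have sub (A B C D : {set 'I_5}) : (forall i, (i \in A :|: B) = (i \in C)) ->
    (forall i, (i \in A :&: B) = (i \in D)) -> r C + r D <= r A + r B.
  by move=> /setP <- /setP <-; apply: rS.
have r034 : r [set v0; v3; v4] + r [set v0] <= r [set v0; v3] + r [set v0; v4].
  by apply: sub => -[[|[|[|[|[|?]]]]] ?] //; rewrite !inE.
have r234 : r [set v2; v3; v4] + r [set v2] <= r [set v2; v3] + r [set v2; v4].
  by apply: sub => -[[|[|[|[|[|?]]]]] ?] //; rewrite !inE.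
have r34 : r [set v0; v2; v3; v4] + r [set v3; v4]
    <= r [set v0; v3; v4] + r [set v2; v3; v4].
  by apply: sub => -[[|[|[|[|[|?]]]]] ?] //; rewrite !inE.
have r134 : r [set v1; v3; v4] + r [set v3] <= r [set v1; v3] + r [set v3; v4].
  by apply: sub => -[[|[|[|[|[|?]]]]] ?] //; rewrite !inE.
have r0234 : r [set v0; v2] <= r [set v0; v2; v3; v4].
  by apply: rM; rewrite ?E12 // -setUA subsetUl.
have r14 : r [set v1; v4] <= r [set v1; v3; v4].
  by apply: rM; rewrite ?E12 // setSU // subsetUl.
have ge1 S c : c <= r1 R S -> S \subset E1 -> m * c <= r S.
  by move=> le_c /H1 ->; rewrite leq_mul2l le_c orbT.
have le1 S c : r1 R S <= c -> S \subset E1 -> r S <= m * c.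
  by move=> le_c /H1 ->; rewrite leq_mul2l le_c orbT.
have ge2 S c : c <= r2 R S -> S \subset E2 -> m * c <= r S.
  by move=> le_c /H2 ->; rewrite leq_mul2l le_c orbT.
have le2 S c : r2 R S <= c -> S \subset E2 -> r S <= m * c.
  by move=> le_c /H2 ->; rewrite leq_mul2l le_c orbT.
have [/ge1 b0 /ge1 b2 /ge1 b3 /ge1 b02 [/le1 b03 /le1 b13 /le1 b23]] :=
  r1_values R.
have [/ge2 b14 /le2 b04 /le2 b24] := r2_values R.
(* The inclusions in [E1] or [E2] that guard the bounds compute to [true]. *)
rewrite !subUset !sub1set !inE /= in b0 b2 b3 b02 b03 b13 b23 b14 b04 b24.
move: (b0 isT) (b2 isT) (b3 isT) (b02 isT) (b03 isT) (b13 isT) (b23 isT).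
move: (b14 isT) (b04 isT) (b24 isT).
(* The sets 034 and 234 have rank at most [2m], and 0234 at least [3m], so 34 has rank at most [m].
   Then 134 has rank at most [2m], but it contains 14, of rank at least [3m]; this is absurd as
   [m > 0]. *)
lia.
Qed.
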